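(* Let $x\in\mathbb{R}$ and $F(t,x)=(1-t-t^{2})^{-x}$ (for $t$ near $0$, where $1-t-t^2>0$). Then for every $N=0,1,2,\dots$, \[ \left(\frac{d}{dt}\right)^{N}F(t,x)=\left(\sum_{i=0}^{\left[\frac{N+1}{2}\right]}a_{i}(N)\langle x\rangle_{N-i}(1+2t)^{N-2i}(1-t-t^{2})^{-N+i}\right)F(t,x), \] where the coefficients $a_i(N)$ are given by: $a_{0}(N)=1$ for all $N\ge0$; $a_{\frac{N+1}{2}}(N)=0$ whenever $N$ is an odd positive integer; and for $1\le i\le\left[\frac{N}{2}\right]$, \[ a_{i}(N)=2^{i}\sum_{k_{i}=1}^{N-2i+1}\sum_{k_{i-1}=1}^{k_{i}+1}\cdots\sum_{k_{1}=1}^{k_{2}+1}\left(\prod_{l=1}^{i}k_{l}\right). \]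
   Context: $[y]$ denotes the greatest integer not exceeding $y$. The rising factorial is $\langle x\rangle_n=x(x+1)\cdots(x+n-1)$ for $n\ge1$, $\langle x\rangle_0=1$. In the nested sum defining $a_i(N)$, the outermost index $k_i$ runs from $1$ to $N-2i+1$ and each inner index $k_{j-1}$ runs from $1$ to $k_j+1$ (for $i=1$ it is the single sum $2\sum_{k_1=1}^{N-1}k_1$). *)

(* Defs.v *)
From Stdlib Require Export Reals ZArith Lra Lia.
From Coquelicot Require Export Coquelicot.
Open Scope R_scope.

Fixpoint rising (x : R) (n : nat) : R :=
  match n with
  | O => 1
  | S m => rising x m * (x + INR m)
  end.

(* [nested_sum i m p] is
     sum_{k_i=1}^{m} sum_{k_{i-1}=1}^{k_i+1} ... sum_{k_1=1}^{k_2+1}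
       p * k_i * ... * k_1;
   the accumulator [p] holds the product of the indices already bound by the
   enclosing sums.  [sum_n_m f 1 0] is the empty sum. *)
Fixpoint nested_sum (i m : nat) (p : R) : R :=
  match i with
  | O => p
  | S j => sum_n_m (fun k : nat => nested_sum j (k + 1) (p * INR k)) 1 m
  end.

(* Only the indices [0 <= i <= (N + 1) / 2] are meaningful.  In the last branch
   this means [1 <= i <= N / 2], so the natural subtraction is exact. *)
Definition a (i N : nat) : R :=
  if Nat.eqb i 0 then 1
  else if Nat.eqb (2 * i) (N + 1) then 0
  else 2 ^ i * nested_sum i (N + 1 - 2 * i) 1.

(* [Rpower] is the real power of a positive base, so [F t x] is meaningful
   where [0 < 1 - t - t ^ 2]. *)
Definition F (t x : R) : R := Rpower (1 - t - t ^ 2) (- x).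

(* Main.v *)
Require Import Defs.
From Stdlib Require Import Reals ZArith.
From Coquelicot Require Import Coquelicot.
Open Scope R_scope.

(** Put [u = 1 - t - t^2]. Differentiating
    [<x>_(N-i) (1+2t)^(N-2i) u^(-x-(N-i))] contributes [1] times the monomial of
    index [i] and [2(N-2i)] times the monomial of index [i+1] at level [N+1].
    So the formula holds with coefficients satisfying
    [a_(i+1)(N+1) = a_(i+1)(N) + 2(N-2i) a_i(N)], and this recurrence is what one
    gets by peeling off the last term of the outermost of the nested sums. *)

(** The accumulator only ever gets multiplied, so it factors out. This allows an inner sum to be
    restarted at [1], as the recurrence below requires. *)
Lemma nested_sum_scal (i m : nat) (p : R) :
  nested_sum i m p = p * nested_sum i m 1.
Proof.
  revert m p; induction i as [|i IH]; intros m p; simpl; [ring|].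
  change (p * ?s) with (mult p s).
  rewrite <- (sum_n_m_mult_l p).
  apply sum_n_m_ext; intros k.
  change (@mult R_Ring) with Rmult.
  rewrite (IH (k + 1)%nat (p * INR k)), (IH (k + 1)%nat (1 * INR k)).
  simpl; ring.
Qed.

Lemma nested_sum_recr (i m : nat) :
  nested_sum (S i) (S m) 1
  = nested_sum (S i) m 1 + INR (S m) * nested_sum i (S (S m)) 1.
Proof.
  simpl nested_sum.
  rewrite sum_n_Sm by lia.
  change (@plus R_AbelianMonoid) with Rplus.
  f_equal.
  rewrite nested_sum_scal, Rmult_1_l.
  now replace (S m + 1)%nat with (S (S m)) by lia.
Qed.

(** Both special branches of [a] are instances of the general formula: [i = 0] leaves the empty
    product, and [2 * i = N + 1] makes the outermost sum empty. *)
Lemma a_nested_sum (i N : nat) : a i N = 2 ^ i * nested_sum i (N + 1 - 2 * i) 1.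
Proof.
  unfold a.
  destruct (Nat.eqb_spec i 0) as [->|Hi]; [simpl; ring|].
  destruct (Nat.eqb_spec (2 * i) (N + 1)) as [H|H]; [|reflexivity].
  replace (N + 1 - 2 * i)%nat with O by lia.
  destruct i; [lia|].
  simpl nested_sum; rewrite sum_n_m_zero by lia.
  change (@zero R_AbelianMonoid) with 0; ring.
Qed.

Lemma a_eq0 (i N : nat) : (N < 2 * i)%nat -> a i N = 0.
Proof.
  intros H; rewrite a_nested_sum.
  replace (N + 1 - 2 * i)%nat with O by lia.
  destruct i; [lia|].
  simpl nested_sum; rewrite sum_n_m_zero by lia.
  change (@zero R_AbelianMonoid) with 0; ring.
Qed.

(* For [N < 2 * i] both the truncated difference and [a i N] vanish. *)
Lemma a_rec (i N : nat) :
  a (S i) (S N) = a (S i) N + 2 * INR (N - 2 * i) * a i N.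
Proof.
  destruct (Nat.le_gt_cases N (2 * i)) as [H|H].
  - rewrite !(a_eq0 (S i)) by lia.
    replace (N - 2 * i)%nat with O by lia; simpl; ring.
  - rewrite !a_nested_sum.
    destruct (N - 2 * i)%nat as [|m] eqn:E; [lia|].
    replace (S N + 1 - 2 * S i)%nat with (S m) by lia.
    replace (N + 1 - 2 * S i)%nat with m by lia.
    replace (N + 1 - 2 * i)%nat with (S (S m)) by lia.
    rewrite nested_sum_recr, <- tech_pow_Rmult; ring.
Qed.

(** The factor [F t x] is absorbed into the real exponent, so only one power of the base has to be
    differentiated. *)
Definition monomial (x : R) (N i : nat) (t : R) : R :=
  rising x (N - i) * (1 + 2 * t) ^ (N - 2 * i)
  * Rpower (1 - t - t ^ 2) (- x - INR (N - i)).

Lemma is_derive_monomial (x : R) (N i : nat) (t : R) :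
  0 < 1 - t - t ^ 2 -> (2 * i <= N)%nat ->
  is_derive (monomial x N i) t
    (monomial x (S N) i t + 2 * INR (N - 2 * i) * monomial x (S N) (S i) t).
Proof.
  intros Hu Hi; unfold monomial.
  replace (S N - i)%nat with (S (N - i)) by lia.
  replace (S N - 2 * i)%nat with (S (N - 2 * i)) by lia.
  replace (S N - S i)%nat with (N - i)%nat by lia.
  (* If [N = 2 * i], the exponent is truncated to [0], but the factor [INR (N - 2 * i)] is then
     zero. *)
  replace (S N - 2 * S i)%nat with (pred (N - 2 * i)) by lia.
  generalize (N - i)%nat (N - 2 * i)%nat; intros m k.
  unfold Rpower.
  auto_derive; [simpl in *; lra|].
  rewrite S_INR.
  replace (exp ((- x - (INR m + 1)) * ln (1 - t - t ^ 2)))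
    with (exp ((- x - INR m) * ln (1 - t - t ^ 2)) / (1 - t - t ^ 2)).
  2: { replace ((- x - (INR m + 1)) * ln (1 - t - t ^ 2))
         with ((- x - INR m) * ln (1 - t - t ^ 2) + - ln (1 - t - t ^ 2)) by ring.
       rewrite exp_plus, exp_Ropp, exp_ln by assumption; reflexivity. }
  replace (1 + - t + - (t * (t * 1))) with (1 - t - t ^ 2) by (simpl; ring).
  replace (1 + - t + - t ^ 2) with (1 - t - t ^ 2) by (simpl; ring).
  simpl rising; simpl ((1 + 2 * t) ^ S k).
  field; simpl in *; lra.
Qed.

(** Summing up to [N] avoids a case split on parity; the terms with [2 * i > N] vanish by
    [a_eq0]. *)
Definition expansion (x : R) (N : nat) (t : R) : R :=
  sum_n (fun i => a i N * monomial x N i t) N.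

Lemma expansion_step (x : R) (N : nat) (t : R) :
  sum_n (fun i => a i N * (monomial x (S N) i t
    + 2 * INR (N - 2 * i) * monomial x (S N) (S i) t)) N
  = expansion x (S N) t.
Proof.
  set (A := fun i => a i N * monomial x (S N) i t).
  set (B := fun i => 2 * INR (N - 2 * i) * a i N * monomial x (S N) (S i) t).
  transitivity (sum_n A N + sum_n B N).
  { change (?p + ?q) with (plus p q).
    rewrite <- sum_n_plus; apply sum_n_ext; intros i.
    change (@plus R_AbelianMonoid) with Rplus; unfold A, B; simpl; ring. }
  transitivity (sum_n A (S N) + sum_n B N).
  { rewrite sum_Sn; change (@plus R_AbelianMonoid) with Rplus.
    unfold A at 3; rewrite (a_eq0 (S N)) by lia; simpl; ring. }
  unfold expansion, sum_n.
  (* The terms of index [0] agree, both coefficients being [1]. The rest is shifted by one to line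
     up with [B], and [a_rec] matches it term by term. *)
  rewrite !(sum_Sn_m _ 0 (S N)) by lia.
  rewrite <- !sum_n_m_S.
  change (@plus R_AbelianMonoid) with Rplus.
  rewrite Rplus_assoc; f_equal.
  change (?p + ?q) with (plus p q).
  rewrite <- sum_n_m_plus; apply sum_n_m_ext; intros i.
  change (@plus R_AbelianMonoid) with Rplus; unfold A, B.
  rewrite a_rec; simpl; ring.
Qed.

Lemma is_derive_expansion (x : R) (N : nat) (t : R) :
  0 < 1 - t - t ^ 2 -> is_derive (expansion x N) t (expansion x (S N) t).
Proof.
  intros Hu; rewrite <- expansion_step; unfold expansion.
  apply (is_derive_sum_n (fun i t => a i N * monomial x N i t)).
  intros i _.
  destruct (Nat.le_gt_cases (2 * i) N) as [H|H].
  - apply (is_derive_scal (monomial x N i)); now apply is_derive_monomial.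
  - rewrite a_eq0, Rmult_0_l by assumption.
    apply (is_derive_ext (fun _ => 0)); [intros s; symmetry; apply Rmult_0_l|].
    apply (is_derive_const (V := R_NormedModule)).
Qed.

Lemma locally_base_pos (t : R) :
  0 < 1 - t - t ^ 2 -> locally t (fun s => 0 < 1 - s - s ^ 2).
Proof.
  intros Hu.
  assert (Hc : continuous (fun s => 1 - s - s ^ 2) t).
  { apply (ex_derive_continuous (V := R_NormedModule)); auto_derive; trivial. }
  apply Hc, (open_gt 0), Hu.
Qed.

Lemma is_derive_n_F (x : R) (N : nat) (t : R) :
  0 < 1 - t - t ^ 2 -> is_derive_n (fun s => F s x) N t (expansion x N t).
Proof.
  revert t; induction N as [|N IH]; intros t Hu.
  - simpl; unfold expansion, monomial, F; rewrite sum_O; simpl.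
    rewrite Rminus_0_r; unfold a; simpl; ring.
  (* The induction hypothesis identifies the [N]-th derivative only where the base is positive; this
     holds near [t], which suffices to differentiate again. *)
  - apply (is_derive_ext_loc (expansion x N)); [|now apply is_derive_expansion].
    apply (filter_imp (fun s => 0 < 1 - s - s ^ 2)); [|now apply locally_base_pos].
    intros s Hs; symmetry; now apply is_derive_n_unique, IH.
Qed.

Lemma monomial_powerRZ (x : R) (N i : nat) (t : R) :
  0 < 1 - t - t ^ 2 -> (2 * i <= N)%nat ->
  monomial x N i t
  = rising x (N - i)
    * powerRZ (1 + 2 * t) (Z.of_nat N - 2 * Z.of_nat i)
    * powerRZ (1 - t - t ^ 2) (- Z.of_nat N + Z.of_nat i) * F t x.
Proof.
  intros Hu Hi; unfold monomial, F.
  replace (Z.of_nat N - 2 * Z.of_nat i)%Z with (Z.of_nat (N - 2 * i)) by lia.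
  rewrite <- pow_powerRZ, powerRZ_Rpower by assumption.
  replace (- Z.of_nat N + Z.of_nat i)%Z with (- Z.of_nat (N - i))%Z by lia.
  rewrite opp_IZR, <- INR_IZR_INZ, !Rmult_assoc, <- Rpower_plus.
  do 3 f_equal; ring.
Qed.

Theorem theorem6 (x : R) (N : nat) (t : R) (ht : 0 < 1 - t - t ^ 2) :
  is_derive_n (fun s : R => F s x) N t
    (sum_n_m (fun i : nat =>
        a i N * rising x (N - i)
        * powerRZ (1 + 2 * t) (Z.of_nat N - 2 * Z.of_nat i)
        * powerRZ (1 - t - t ^ 2) (- Z.of_nat N + Z.of_nat i))
      0 ((N + 1) / 2)
     * F t x).
Proof.
  match goal with |- is_derive_n _ _ _ ?l => replace l with (expansion x N t) end;
    [now apply is_derive_n_F|].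
  assert (Hdiv : (N + 1 = 2 * ((N + 1) / 2) + (N + 1) mod 2)%nat)
    by (apply Nat.div_mod_eq).
  assert (Hmod : ((N + 1) mod 2 < 2)%nat) by (apply Nat.mod_upper_bound; lia).
  unfold expansion, sum_n.
  rewrite (sum_n_m_Chasles _ 0 ((N + 1) / 2) N) by lia.
  rewrite (sum_n_m_ext_loc _ (fun _ => zero) (S _)).
  2: { intros i [Hi _]; rewrite a_eq0 by lia; apply Rmult_0_l. }
  rewrite sum_n_m_const_zero, plus_zero_r.
  change (?s * F t x) with (mult s (F t x)).
  rewrite <- (sum_n_m_mult_r (F t x)).
  apply sum_n_m_ext; intros i.
  change (@mult R_Ring) with Rmult.
  destruct (Nat.le_gt_cases (2 * i) N) as [H|H].
  - rewrite monomial_powerRZ by assumption; simpl; ring.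
  (* Within the range this is [i = (N + 1) / 2] with [N] odd: the exponent of [1 + 2 * t] is [-1],
     and the zero coefficient removes the term even at [t = -1/2]. *)
  - rewrite a_eq0 by assumption; simpl; ring.
Qed.
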